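(* Let $n\ge1$ and let $\pi,\sigma,\tau\in\mathcal{D}_n$. Suppose that there exist $01$-words $u,\sigma',\pi',v$ such that $$\sigma=u\sigma'v\quad\text{and}\quad\pi=u\pi'v.$$ Let $a,b$ be defined by $n-a=|u|_0+|v|_0$ and $n-b=|u|_1+|v|_1$. Then $t_{\sigma,\tau}^\pi=0$ unless $\tau$ is of the form $$\tau=0^{n-a}\,\tau'\,1^{n-b}$$ for a certain word $\tau'$.
   Context: A $01$-word is a finite word on the alphabet $\{0,1\}$; $|u|_0$ and $|u|_1$ denote the numbers of $0$s and $1$s in $u$; juxtaposition is concatenation. $\mathcal{D}_n$ is the set of $01$-words $\sigma=\sigma_1\cdots\sigma_{2n}$ with $n$ zeros and $n$ ones such that each prefix contains at least as many $0$s as $1$s. A word $\pi\in\mathcal D_n$ is identified with the noncrossing perfect matching of $\{1,\dots,2n\}$ obtained by reading $0$ as an opening and $1$ as a closing parenthesis. **The triangle.** $\mathcal{T}^n$ is the graph with vertices $(x,y)\in\mathbb{Z}^2$, $x\ge y\ge 0$, $x+y\le 4n-2$, with all unit horizontal and vertical edges between these vertices, together with $2n$ external (half-)edges: the $i$th one hangs vertically below the vertex $(2i-2,0)$, $i=1,\dots,2n$. The left boundary vertices are $L_i=(i-1,i-1)$ and the right boundary vertices are $R_i=(2n-2+i,2n-i)$, $i=1,\dots,2n$ (so $L_{2n}=R_1$). **TFPL configurations.** For $\sigma,\tau,\pi\in\mathcal{D}_n$, $t_{\sigma,\tau}^\pi$ is the number of subgraphs (edge sets) $f$ of $\mathcal{T}^n$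 such that: - all $2n$ external edges belong to $f$; - every vertex other than the $L_i$ and $R_i$ is incident to exactly two edges of $f$; - for $1\le i\le 2n-1$ the horizontal edge from $L_i$ to its right neighbour is in $f$; for $2\le i\le 2n$ the vertical edge just below $L_i$ is in $f$ if and only if $\sigma_i=0$; - for $2\le i\le 2n$ the horizontal edge from $R_i$ to its left neighbour is in $f$; for $1\le i\le 2n-1$ the vertical edge just below $R_i$ is in $f$ if and only if $\tau_i=1$; - the $n$ vertices $L_i$ with $\sigma_i=1$ are the starting points of $n$ paths of $f$ whose other endpoints are the $n$ vertices $R_j$ with $\tau_j=0$ (the path at the vertex $L_{2n}=R_1$ is reduced to this single vertex), and the external edges $i$ and $j$ are the two ends of the same path of $f$ if and only if $\{i,j\}$ is a pair of the matching $\pi$. Closed paths are allowed. *)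

(* Defs.v *)
From mathcomp Require Import all_boot.
From mathcomp Require Import finmap boolp.

Set Implicit Arguments.
Unset Strict Implicit.
Unset Printing Implicit Defensive.

Local Open Scope fset_scope.
Local Open Scope nat_scope.

(* The letter 0 is [false], the letter 1 is [true]. *)
Definition word := seq bool.
Definition c0 : bool := false.
Definition c1 : bool := true.

Definition zeros (w : word) : nat := count_mem c0 w.
Definition ones (w : word) : nat := count_mem c1 w.

(* w_i, with indices starting at 1. *)
Definition letter (w : word) (i : nat) : bool := nth c0 w i.-1.

Definition balanced (w : word) : bool :=
  (zeros w == ones w) &&
  all (fun k => ones (take k w) <= zeros (take k w)) (iota 0 (size w).+1).

(* The set D_n. *)
Definition dyck (n : nat) : pred word :=
  [pred w | [&& balanced w, zeros w == n & ones w == n]].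

(* For i < j, {i, j} is a pair of the matching of w: the parenthesis opened at
   i is closed at j, i.e. the factor w_{i+1} ... w_{j-1} is well parenthesized. *)
Definition matched (w : word) (i j : nat) : bool :=
  [&& 1 <= i, i < j, j <= size w, letter w i == c0, letter w j == c1
    & balanced (take (j - i.+1) (drop i w))].

Definition point : Type := (nat * nat)%type.

Definition in_triangle (n : nat) (p : point) : bool :=
  (p.2 <= p.1) && (p.1 + p.2 <= 4 * n - 2).

(* L_i, R_i, and the endpoint of the i-th external edge, for 1 <= i <= 2n. *)
Definition L (i : nat) : point := (i - 1, i - 1).
Definition R (n i : nat) : point := (2 * n - 2 + i, 2 * n - i).
Definition B (i : nat) : point := (2 * i - 2, 0).

(* [hor p] joins p = (x, y) to (x + 1, y); [ver p] is the edge just below p: it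
   joins (x, y) to (x, y - 1) if y > 0, and is a half-edge attached to p only
   if y = 0.  Hence the i-th external edge is [ver (B i)]. *)
Definition edge : Type := (point + point)%type.
Definition hor (p : point) : edge := inl p.
Definition ver (p : point) : edge := inr p.

Definition incident (e : edge) (q : point) : bool :=
  match e with
  | inl p => (q == p) || (q == (p.1.+1, p.2))
  | inr p => (q == p) || ((q.1 == p.1) && (q.2.+1 == p.2))
  end.

Definition is_edge (n : nat) (e : edge) : bool :=
  match e with
  | inl p => in_triangle n p && in_triangle n (p.1.+1, p.2)
  | inr (x, 0) => (x, 0) \in [seq B i | i <- iota 1 (2 * n)]
  | inr (x, y.+1) => in_triangle n (x, y.+1) && in_triangle n (x, y)
  end.

(* All edges of T^n; the enclosing box only serves to make the set finite. *)
Definition triangle_edges (n : nat) : {fset edge} :=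
  let box := [seq (x, y) | x <- iota 0 (4 * n), y <- iota 0 (4 * n)] in
  [fset e in [seq hor p | p <- box] ++ [seq ver p | p <- box] | is_edge n e].

Definition degree (f : {fset edge}) (q : point) : nat :=
  #|` [fset e in f | incident e q]|.

Definition joined (f : {fset edge}) (p q : point) : bool :=
  (p != q) && has (fun e => incident e p && incident e q) f.

(* p and q are the extremities of a (possibly one-vertex) path of f. *)
Definition linked (f : {fset edge}) (p q : point) : Prop :=
  exists s : seq point,
    [/\ path (joined f) p s, last p s = q & uniq (p :: s)].

(* The indices i with w_i = c, among 1, ..., 2n. *)
Definition positions (n : nat) (c : bool) (w : word) : seq nat :=
  [seq i <- iota 1 (2 * n) | letter w i == c].

(* [tfpl_match] determines a bijection from the L_i with sigma_i = 1 to the R_j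
   with tau_j = 0, whose paths lie in f. *)
Record tfpl (n : nat) (sigma tau pi : word) (f : {fset edge}) : Prop := Tfpl {
  tfpl_external : forall i, 1 <= i <= 2 * n -> ver (B i) \in f;
  tfpl_degree : forall p, in_triangle n p ->
    (forall i, 1 <= i <= 2 * n -> p <> L i /\ p <> R n i) -> degree f p = 2;
  tfpl_left_hor : forall i, 1 <= i <= 2 * n - 1 -> hor (L i) \in f;
  tfpl_left_ver : forall i, 2 <= i <= 2 * n ->
    (ver (L i) \in f <-> letter sigma i = c0);
  tfpl_right_hor : forall i, 2 <= i <= 2 * n ->
    hor ((R n i).1 - 1, (R n i).2) \in f;
  tfpl_right_ver : forall i, 1 <= i <= 2 * n - 1 ->
    (ver (R n i) \in f <-> letter tau i = c1);
  tfpl_match : exists r : nat -> nat,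
    perm_eq [seq r i | i <- positions n c1 sigma] (positions n c0 tau) /\
    forall i : nat, i \in positions n c1 sigma -> linked f (L i) (R n (r i));
  tfpl_bottom : forall i j, 1 <= i -> i < j -> j <= 2 * n ->
    (linked f (B i) (B j) <-> matched pi i j)
}.

(* t_{sigma,tau}^pi *)
Definition tfpl_count (n : nat) (sigma tau pi : word) : nat :=
  #|` [fset f in fpowerset (triangle_edges n) | `[< tfpl n sigma tau pi f >]]|.

(* Main.v *)
Require Import Defs.
From mathcomp Require Import all_boot.
From mathcomp Require Import finmap boolp zify.

(* Orient f: the path between two external edges goes from the opening to the
   closing one, the path between L_i and R_j goes from L_i to R_j, and each
   closed path is oriented arbitrarily.  Call a vertex (x, y) odd when x + y is
   even, as are all L_i, R_i and B_i; the odd vertices lie on the antidiagonals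
   from L_i to B_i, and the even vertices on the antidiagonals in between.
   Every even vertex has exactly one incoming and one outgoing edge, and most odd
   vertices do too.  The proof follows these edges from one antidiagonal to the
   next, using how sigma and pi determine the boundary vertices on its ends.

   In the levels i indexing u, and in those indexing v, all edges from even to
   odd vertices lead to the next antidiagonal, and they are all vertical when the
   common letter is 0, all horizontal when it is 1.  The edges from odd to even
   vertices going back one antidiagonal avoid these, so that the set of even
   vertices reached by them is pushed away from the left boundary at each common
   0, and fills one more of the lowest places at each common 1.  On the right
   boundary these edges are the vertical ones, which encode tau. *)

Set Implicit Arguments.
Unset Strict Implicit.
Unset Printing Implicit Defensive.

(** * Orienting a graph of maximal degree two *)

Section Orientation.

Variables (T : countType) (adj : rel T) (src snk : T -> Prop).

Hypothesis adj_sym : symmetric adj.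
Hypothesis adj_irr : irreflexive adj.
Hypothesis adj_deg2 : forall q p r t,
  adj q p -> adj q r -> adj q t -> p <> r -> p <> t -> r = t.
Hypothesis end_deg1 : forall v p q, src v \/ snk v -> adj v p -> adj v q -> p = q.
Hypothesis src_snk : forall v, src v -> snk v -> False.

Definition simple_path (p q : T) : Prop :=
  exists s, [/\ path adj p s, last p s = q & uniq (p :: s)].

Hypothesis src_linked : forall v, src v -> exists2 w, snk w & simple_path v w.
Hypothesis snk_linked : forall w, snk w -> exists2 v, src v & simple_path v w.

Definition dart := (T * T)%type.
Definition rv (d : dart) : dart := (d.2, d.1).

Definition step (d d' : dart) : Prop :=
  [/\ d'.1 = d.2, adj d.1 d.2, adj d'.1 d'.2 & d.1 <> d'.2].

(** Since [step] forbids turning back and degrees are at most two, each dart has at most one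
    successor and one predecessor, so that walks are determined in both directions. *)
Fixpoint reachn (k : nat) (d d' : dart) : Prop :=
  if k is k'.+1 then exists2 x, step d x & reachn k' x d' else d = d'.

Definition reach (d d' : dart) : Prop := exists k, reachn k d d'.

Lemma rvK : involutive rv. Proof. by case. Qed.

Lemma step_det d x y : step d x -> step d y -> x = y.
Proof.
case: d x y => p q [q1 x] [q2 y] [/= -> apq aqx nx] [/= -> _ aqy ny].
by congr pair; apply: (@adj_deg2 q p); rewrite // adj_sym.
Qed.

Lemma step_rv d x : step d x -> step (rv x) (rv d).
Proof.
by case: d x => p q [q1 x] [/= -> apq aqx nx]; split=> //=; rewrite 1?adj_sym // => E; apply: nx.
Qed.

Lemma step_codet d x y : step x d -> step y d -> x = y.
Proof.
move=> /step_rv sx /step_rv sy.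
by rewrite -[x]rvK -[y]rvK; congr rv; apply: step_det sx sy.
Qed.

Lemma reachn_last k d d' :
  reachn k.+1 d d' <-> exists2 x, reachn k d x & step x d'.
Proof.
elim: k d => [|k IH] d.
  by split=> [[x s <-]|[x <- s]]; [exists d | exists d'].
split.
- by case=> x s /IH[y r s']; exists y => //; exists x.
- by case=> y [x s r] s'; exists x => //; apply/IH; exists y.
Qed.

Lemma reachn_rv k d d' : reachn k d d' -> reachn k (rv d') (rv d).
Proof.
elim: k d => [|k IH] d /=; first by move->.
by case=> x s /IH r; apply/reachn_last; exists (rv x) => //; apply: step_rv.
Qed.

Lemma reach_rv d d' : reach d d' -> reach (rv d') (rv d).
Proof. by case=> k /reachn_rv r; exists k. Qed.

Lemma reach_refl d : reach d d. Proof. by exists 0. Qed.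

Lemma reach_trans d x y : reach d x -> reach x y -> reach d y.
Proof.
case=> k; elim: k d => [|k IH] d /=; first by move->.
by case=> z s r /(IH _ r)[m r']; exists m.+1, z.
Qed.

Lemma step_reach d x : step d x -> reach d x.
Proof. by move=> s; exists 1, x. Qed.

Lemma reach_step d x y : step d x -> reach d y -> y = d \/ reach x y.
Proof.
move=> s [[|k] /=]; first by left.
by case=> z /(step_det s) <- r; right; exists k.
Qed.

Lemma reach_stepr d x y : step x d -> reach y d -> y = d \/ reach y x.
Proof.
move=> s [[|k]]; first by left.
by case/reachn_last=> z r /(step_codet s) ->; right; exists k.
Qed.

Lemma reach_fork d x y : reach d x -> reach d y -> reach x y \/ reach y x.
Proof.
case=> k; elim: k d => [|k IH] d /=; first by move->; left.
case=> z s r /(reach_step s)[->|/(IH _ r)//].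
by right; exists k.+1, z.
Qed.

Lemma reach_join d x y : reach x d -> reach y d -> reach x y \/ reach y x.
Proof.
move=> /reach_rv rx /reach_rv ry.
by have [/reach_rv|/reach_rv] := reach_fork rx ry; rewrite !rvK; [right|left].
Qed.

(* A walk from a dart to its reverse would be a palindrome, turning around in
   its middle. *)
Lemma no_reach_rv d : adj d.1 d.2 -> ~ reach d (rv d).
Proof.
move=> ad [k]; elim/ltn_ind: k d ad => -[|[|k]] IH d ad.
- by case: d ad => p q /= ad [E _]; rewrite E adj_irr in ad.
- by case: d ad => p q /= ad [x [/= _ _ _ ne] E]; apply: ne; rewrite E.
- case=> x s /reachn_last[y r s'].
  have E : x = rv y by apply: step_det s _; rewrite -[d]rvK; apply: step_rv.
  apply: (IH k _ x); [lia | by case: s | by rewrite E rvK -E].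
Qed.

(** A class consists of the darts of one maximal directed walk; the two directions of a path or of a
    cycle give two classes. *)
Definition cls (d d' : dart) : bool := `[< reach d d' \/ reach d' d >].

Lemma cls_step d x : step d x -> cls d =1 cls x.
Proof.
move=> s y; apply/asboolP/asboolP.
- case=> r; last by right; apply: reach_trans r (step_reach s).
  by have [->|] := reach_step s r; [right; apply: step_reach | left].
- case=> r; first by left; apply: reach_trans (step_reach s) r.
  by have [->|] := reach_stepr s r; [left; apply: step_reach | right].
Qed.

(** A closed path has no distinguished dart. The canonical one given by [choose] depends only on the
    class, hence is constant along a walk. *)
Definition rep (d : dart) : dart := choose (cls d) d.

Lemma cls_refl d : cls d d.
Proof. by apply/asboolP; left; apply: reach_refl. Qed.

Lemma rep_cls d : cls d (rep d).
Proof. exact: chooseP (cls_refl d). Qed.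

Lemma rep_step d x : step d x -> rep d = rep x.
Proof.
move=> s; have e := cls_step s; rewrite /rep (eq_choose e).
by apply: choose_id; rewrite ?cls_refl // -e cls_refl.
Qed.

(** With a common representative, [reach_fork] and [reach_join] would put [d] and [rv d] on one
    walk. *)
Lemma rep_rv d : adj d.1 d.2 -> rep d <> rep (rv d).
Proof.
move=> ad E; have := rep_cls d; have := rep_cls (rv d); rewrite -E.
have nr := no_reach_rv ad.
have nr' : ~ reach (rv d) d.
  by rewrite -{2}[d]rvK; apply: no_reach_rv; rewrite adj_sym.
move=> /asboolP[] r1 /asboolP[] r2.
- by case: (reach_join r1 r2).
- by apply: nr'; apply: reach_trans r1 r2.
- by apply: nr; apply: reach_trans r2 r1.
- by case: (reach_fork r1 r2).
Qed.

Definition good (d : dart) : Prop :=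
  exists2 d0, src d0.1 /\ adj d0.1 d0.2 & reach d0 d.

Lemma no_step_to_end d d0 : src d0.1 \/ snk d0.1 -> ~ step d d0.
Proof.
case: d d0 => p q [q0 r] /= e [/= E apq aqr ne]; subst.
by apply: ne; apply: end_deg1 e _ aqr; rewrite adj_sym.
Qed.

Lemma no_step_from_end d d0 : src d0.2 \/ snk d0.2 -> ~ step d0 d.
Proof. by move=> e /step_rv; apply: no_step_to_end. Qed.

Lemma good_step d x : step d x -> good d <-> good x.
Proof.
move=> s; split; case=> d0 sd r; exists d0 => //.
- exact: reach_trans r (step_reach s).
- have [E|//] := reach_stepr s r; case: (@no_step_to_end d x) => //.
  by left; rewrite -E; case: sd.
Qed.

Lemma path_reach v x s : adj v x -> path adj x s -> uniq [:: v, x & s] ->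
  exists2 y, adj y (last x s) & reach (v, x) (y, last x s).
Proof.
elim: s v x => [|y s IH] v x avx /=; first by exists v => //; apply: reach_refl.
case/andP=> axy ps /andP[vn u]; have [y' a r] := IH x y axy ps u.
exists y' => //; apply: reach_trans r; apply: step_reach; split=> //= E.
by rewrite E !inE eqxx orbT in vn.
Qed.

Lemma linked_reach v w : src v -> snk w -> simple_path v w ->
  exists x y, [/\ adj v x, adj y w & reach (v, x) (y, w)].
Proof.
move=> sv sw [[|x s] [/= + lw]]; first by case: (src_snk sv); rewrite lw.
case/andP=> avx ps u; have [y a r] := path_reach avx ps u.
by exists x, y; rewrite -lw.
Qed.

Lemma good_src v p : src v -> adj v p -> good (v, p).
Proof. by move=> sv a; exists (v, p) => //; apply: reach_refl. Qed.

(** The path that joins some source to [w] must arrive by the only edge at [w]. *)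
Lemma good_snk w p : snk w -> adj p w -> good (p, w).
Proof.
move=> sw a; have [v sv l] := snk_linked sw.
have [x [y [a1 a2 r]]] := linked_reach sv sw l; exists (v, x) => //.
suff -> : p = y by [].
by apply: (@end_deg1 w); [right | rewrite adj_sym | rewrite adj_sym].
Qed.

(** Otherwise the walk leaving the source [v] would enter a source [v']. It also enters a sink [w]
    and cannot go on after either of them, so [v'] and [w] would coincide. *)
Lemma good_rv d : good d -> ~ good (rv d).
Proof.
case=> -[v x] [/= sv avx] r [[v' x'] [/= sv' avx'] /reach_rv]; rewrite rvK => r'.
have [w sw l] := src_linked sv.
have [x1 [y [a1 a2 r1]]] := linked_reach sv sw l.
have E : x = x1 by apply: (@end_deg1 v) => //; left.
subst x1; have stuck e z : src z.2 \/ snk z.2 -> reach z e -> e = z.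
  by move=> ez [[|k]] // [z' /(no_step_from_end ez)].
have [r2|r2] := reach_fork (reach_trans r r') r1.
- by have [_ E] := stuck _ (x', v') (or_introl sv') r2; apply: (src_snk sv'); rewrite -E.
- by have [_ E] := stuck _ (y, w) (or_intror sw) r2; apply: (src_snk sv'); rewrite E.
Qed.

(** An edge met by a walk from a source follows that walk. For the other edges, such as those of
    closed paths, the codes of the representatives of the two directions break the tie. *)
Definition orient (p q : T) : bool :=
  adj p q && (`[< good (p, q) >] ||
    ~~ `[< good (q, p) >] && (choice.pickle (rep (p, q)) < choice.pickle (rep (q, p)))).

Lemma orient_rv p q : adj p q -> orient q p = ~~ orient p q.
Proof.
move=> a; rewrite /orient a adj_sym a /=.
case: asboolP => g1; case: asboolP => g2 //=; first by case: (good_rv g1).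
rewrite -leqNgt ltn_neqAle; case: eqP => // /(pcan_inj choice.pickleK) E.
by have := rep_rv (d := (p, q)) a; rewrite E.
Qed.

Lemma orient_step p q r : adj p q -> adj q r -> p <> r -> orient p q = orient q r.
Proof.
move=> apq aqr ne; have st : step (p, q) (q, r) by [].
have st' := step_rv st.
rewrite /orient apq aqr (rep_step st) -(rep_step st') /=.
by rewrite (asbool_equiv_eq (good_step st)) -(asbool_equiv_eq (good_step st')).
Qed.

Lemma orient_src v p : src v -> adj v p -> orient v p.
Proof. by move=> sv a; rewrite /orient a; case: asboolP => // -[]; apply: good_src. Qed.

Lemma orient_snk w p : snk w -> adj p w -> orient p w.
Proof. by move=> sw a; rewrite /orient a; case: asboolP => // -[]; apply: good_snk. Qed.

Lemma orient_adj p q : orient p q -> adj p q.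
Proof. by case/andP. Qed.

End Orientation.

(** * Heights of Dyck words *)

Lemma letter_cases w i : letter w i = c0 \/ letter w i = c1.
Proof. by case: (letter w i); [right | left]. Qed.

Lemma zeros_ones w : zeros w + ones w = size w.
Proof. by rewrite /zeros /ones -(count_predC (pred1 c0)); congr (_ + _); apply: eq_count => -[]. Qed.

Lemma count_takeS c (w : word) k : k < size w ->
  count_mem c (take k.+1 w) = count_mem c (take k w) + (letter w k.+1 == c).
Proof. by move=> kw; rewrite (take_nth c0) // -cats1 count_cat /= addn0. Qed.

Lemma zeros_takeS (w : word) k : k < size w ->
  zeros (take k.+1 w) = zeros (take k w) + (letter w k.+1 == c0).
Proof. exact: count_takeS. Qed.

Lemma ones_takeS (w : word) k : k < size w ->
  ones (take k.+1 w) = ones (take k w) + (letter w k.+1 == c1).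
Proof. exact: count_takeS. Qed.

Lemma dyckP n w : w \in dyck n ->
  [/\ size w = 2 * n, zeros w = n, ones w = n &
      forall k, ones (take k w) <= zeros (take k w)].
Proof.
case/and3P=> /andP[_ /allP pre] /eqP z /eqP o; split=> //.
  by rewrite -zeros_ones z o mul2n addnn.
move=> k; have [kw|/ltnW/take_oversize ->] := leqP k (size w); last by rewrite z o.
by apply: pre; rewrite mem_iota.
Qed.

Lemma dyck_first n w : w \in dyck n -> 0 < n -> letter w 1 = c0.
Proof.
case/dyckP=> sw _ _ /(_ 1) pre n0; move: pre.
rewrite zeros_takeS ?ones_takeS ?take0; [|lia|lia].
by case: (letter w 1).
Qed.

Lemma dyck_last n w : w \in dyck n -> 0 < n -> letter w (2 * n) = c1.
Proof.
case/dyckP=> sw zw ow /(_ (2 * n).-1) pre n0; move: pre.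
have lt : (2 * n).-1 < size w by lia.
have := zeros_takeS lt; have := ones_takeS lt.
rewrite (_ : (2 * n).-1.+1 = size w) ?take_size ?zw ?ow; last lia.
by rewrite sw; case: (letter w (2 * n)) => //=; lia.
Qed.

(** The height of a prefix is its number of zeros minus its number of ones. Heights are compared by
    moving the ones across, since subtraction in [nat] truncates. *)
Lemma matched_height w i j : 0 < i -> i < j -> j <= size w ->
  letter w i = c0 -> letter w j = c1 ->
  zeros (take i w) + ones (take j.-1 w) = zeros (take j.-1 w) + ones (take i w) ->
  (forall k, i <= k < j ->
     zeros (take i w) + ones (take k w) <= zeros (take k w) + ones (take i w)) ->
  matched w i j.
Proof.
move=> i0 ij jw wi wj eqh leh; rewrite /matched i0 ij jw wi wj /=.
have cut c k : count_mem c (take (i + k) w) =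
    count_mem c (take i w) + count_mem c (take k (drop i w)).
  by rewrite takeD count_cat.
have cutz k := cut c0 k; have cuto k := cut c1 k.
apply/andP; split.
  have := cutz (j - i.+1); have := cuto (j - i.+1).
  rewrite (_ : i + (j - i.+1) = j.-1); last lia.
  by rewrite /zeros /ones in eqh *; move=> eo ez; apply/eqP; lia.
apply/allP=> k; rewrite mem_iota size_take size_drop => kj.
have kj' : k <= j - i.+1 by move: kj; case: ifP; lia.
rewrite take_takel //.
have := cutz k; have := cuto k; have := leh (i + k).
by rewrite /zeros /ones => + eo ez; rewrite eo ez; lia.
Qed.

Lemma dyck_close n w i : w \in dyck n -> 0 < i <= 2 * n -> letter w i = c0 ->
  exists j, [/\ i < j, j <= 2 * n, letter w j = c1 & matched w i j].
Proof.
case/dyckP=> sw zw ow pre in0 wi.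
(* The partner of [i] is the first position after which the height is below its value after [i]. *)
pose P j := (i < j) &&
  (zeros (take j w) + ones (take i w) < zeros (take i w) + ones (take j w)).
have iw : i.-1 < size w by lia.
have zi := zeros_takeS iw; have oi := ones_takeS iw.
rewrite prednK ?wi /= in zi oi; try lia.
have exP : exists j, P j.
  exists (2 * n); have ne : i <> 2 * n.
    move=> ie; move: zi oi (pre i.-1); rewrite ie -sw take_size zw ow; lia.
  by rewrite /P -sw take_size sw zw ow; have := pre i.-1; lia.
have [j /andP[ij hj] minj] := ex_minnP exP.
have jn : j <= 2 * n.
  have [//|nj] := leqP j (2 * n); have /minj : P (2 * n).
    have ne : i <> 2 * n.
      move=> ie; move: zi oi (pre i.-1); rewrite ie -sw take_size zw ow; lia.
    by rewrite /P -sw take_size sw zw ow; have := pre i.-1; lia.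
  lia.
have below k : i <= k < j ->
    zeros (take i w) + ones (take k w) <= zeros (take k w) + ones (take i w).
  case/andP; rewrite leq_eqVlt => /orP[/eqP<- //|ik] kj.
  have [//|lt] := leqP (zeros (take i w) + ones (take k w)) _.
  have /minj : P k by rewrite /P ik.
  lia.
have jw : j.-1 < size w by lia.
have zj := zeros_takeS jw; have oj := ones_takeS jw.
rewrite prednK in zj oj; try lia.
have := below j.-1.
have [lj|lj] := letter_cases w j; rewrite lj /= in zj oj; first by lia.
exists j; split=> //; apply: matched_height => //; lia.
Qed.

Lemma dyck_open n w j : w \in dyck n -> 0 < j <= 2 * n -> letter w j = c1 ->
  exists i, [/\ 0 < i, i < j, letter w i = c0 & matched w i j].
Proof.
case/dyckP=> sw zw ow pre jn wj.
(* The partner of [j] is the last position before which the height does not exceed its value after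
   [j]. *)
pose P i := (0 < i <= j) &&
  (zeros (take i.-1 w) + ones (take j w) <= zeros (take j w) + ones (take i.-1 w)).
have exP : exists i, P i.
  by exists 1; rewrite /P take0 /=; have := pre j; rewrite /zeros /ones /=; lia.
have ubP i : P i -> i <= j by case/andP=> /andP[].
have [i /andP[/andP[i0 ij] hi] maxi] := ex_maxnP exP ubP.
have jw : j.-1 < size w by lia.
have zj := zeros_takeS jw; have oj := ones_takeS jw.
rewrite prednK in zj oj; try lia.
rewrite wj /= in zj oj.
have ij' : i < j.
  rewrite ltn_neqAle ij andbT; apply/eqP=> E; rewrite E in hi; lia.
have above k : i <= k < j ->
    zeros (take j w) + ones (take k w) < zeros (take k w) + ones (take j w).
  move=> /andP[ik kj]; rewrite ltnNge; apply/negP => le.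
  have /maxi : P k.+1 by rewrite /P /= kj; lia.
  lia.
have iw : i.-1 < size w by lia.
have zi := zeros_takeS iw; have oi := ones_takeS iw.
rewrite prednK in zi oi; try lia.
have ai := above i.
have [li|li] := letter_cases w i; rewrite li /= in zi oi; last by lia.
exists i; split=> //; apply: matched_height => //; first lia.
  lia.
by move=> k hk; have := above k hk; lia.
Qed.

Lemma count_letter c (x w y : word) :
  count (fun j => letter (x ++ w ++ y) j == c) (iota (size x).+1 (size w)) =
  count_mem c w.
Proof.
rewrite -[(size x).+1]addn0 iotaDl count_map -[in RHS](mkseq_nth c0 w) count_map.
apply: eq_in_count => k; rewrite mem_iota => /andP[_ kw] /=.
by rewrite /letter /= nth_cat ltnNge leq_addr /= addKn nth_cat kw.
Qed.

(** * Edges between antidiagonals *)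

(* The even vertex (i, y) is the one at height y on the i-th even antidiagonal,
   0 <= y < i < N; the odd vertex (i, y) is at height y on the antidiagonal from
   L_i (y = i - 1) to B_i (y = 0), i <= N.  [target] sends an even vertex to its
   odd neighbours. *)
Inductive dir := Lf | Dn | Rt | Up.

Definition target (i y : nat) (d : dir) : nat * nat :=
  match d with
  | Lf => (i, y) | Dn => (i, y.-1) | Rt => (i.+1, y) | Up => (i.+1, y.+1)
  end.

Definition rising (d : dir) : bool := if d is (Rt | Up) then true else false.

Section Levels.

(* The edge entering the even vertex (i, y) lies in direction [d1 i y], the one
   leaving it in direction [d2 i y]. *)
Variables (N : nat) (s p : nat -> bool) (d1 d2 : nat -> nat -> dir).

Definition hit (d : nat -> nat -> dir) (o : nat * nat) (i y : nat) : Prop :=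
  [/\ y < i, i < N & target i y (d i y) = o].

(** In the application [N] is $2n$, and [s] and [p] give the letters of [sigma] and [pi]. The
    exceptions in the hypotheses below come from the ends of paths. *)
Hypothesis inj1 : forall o i y i' y', hit d1 o i y -> hit d1 o i' y' -> i = i' /\ y = y'.
Hypothesis inj2 : forall o i y i' y', hit d2 o i y -> hit d2 o i' y' -> i = i' /\ y = y'.
Hypothesis d12 : forall i y, y < i -> i < N -> d1 i y <> d2 i y.
(** At height 0, [target] does not distinguish [Dn] from [Lf], because [0.-1] is 0. *)
Hypothesis dn1 : forall i, 0 < i -> i < N -> d1 i 0 <> Dn.
Hypothesis dn2 : forall i, 0 < i -> i < N -> d2 i 0 <> Dn.
(** Level [N] is left out: which of its odd vertices have a leaving edge depends on [tau]. *)
Hypothesis cov1 : forall i y, y < i -> i < N -> ~~ ((y == 0) && p i) ->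
  exists i' y', hit d1 (i, y) i' y'.
Hypothesis cov2 : forall i y, y < i -> i <= N -> ~~ ((y == 0) && ~~ p i) ->
  ~~ ((y.+1 == i) && s i) -> exists i' y', hit d2 (i, y) i' y'.
Hypothesis bot1 : forall i i' y', p i -> ~ hit d1 (i, 0) i' y'.
Hypothesis bot2 : forall i i' y', ~~ p i -> ~ hit d2 (i, 0) i' y'.
Hypothesis top2 : forall i i' y', s i.+1 -> ~ hit d2 (i.+1, i) i' y'.

(** * Levels whose leaving edges all lead to the next antidiagonal *)

Definition clear (i : nat) : Prop := forall y, y < i -> i < N -> rising (d2 i y).

(** The bottom odd vertex of level [i.+1] receives no edge, which rules out [Rt] at height 0. Then
    each [Up] occupies the vertex that [Rt] would reach from the next height. *)
Lemma all_up i : i < N -> clear i -> ~~ p i.+1 -> forall y, y < i -> d2 i y = Up.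
Proof.
move=> iN ci pi; elim=> [|y IH] yi; have := ci _ yi iN.
- case E: (d2 i 0) => // _; exfalso; apply: (@bot2 i.+1 i 0 pi).
  by split=> //; rewrite E.
- case E: (d2 i y.+1) => // _; exfalso.
  have [] : i = i /\ y = y.+1; last by lia.
  apply: (@inj2 (i.+1, y.+1)); split=> //; first lia.
  + by rewrite IH //; lia.
  + by rewrite E.
Qed.

(** The same propagation, downwards from the top odd vertex, which receives no edge. *)
Lemma all_right i : i < N -> clear i -> s i.+1 -> forall y, y < i -> d2 i y = Rt.
Proof.
move=> iN ci si y yi.
have: forall k, k < i -> d2 i (i - k.+1) = Rt; last first.
  by move=> /(_ (i - y.+1)); rewrite (_ : i - (i - y.+1).+1 = y); [apply; lia | lia].
elim=> [|k IH] ki.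
- have ki' : i - 1 < i by lia.
   have := ci _ ki' iN; case E: (d2 i _) => // _; exfalso.
  apply: (@top2 _ i (i - 1) si); split=> //.
  by rewrite E /= (_ : (i - 1).+1 = i) //; lia.
- have ki' : i - k.+1 < i by lia.
  have lt : i - k.+2 < i by lia.
  have := ci _ lt iN; case E: (d2 i _) => // _; exfalso.
  have [] : i = i /\ i - k.+2 = i - k.+1; last by lia.
  apply: (@inj2 (i.+1, i - k.+1)); split=> //.
  + by rewrite E /= (_ : (i - k.+2).+1 = i - k.+1) //; lia.
  + by rewrite IH //; lia.
Qed.

(** The edges from level [j] already occupy every odd vertex of level [j.+1] able to receive one, so
    the even vertices of level [j.+1] find none free on their own level. *)
Lemma clear_prefix j :
  (forall k, 0 < k <= j -> s k = p k) -> clear j.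
Proof.
elim: j => [|j IH] sp; first by [].
have cj : clear j by apply: IH => k kj; apply: sp; lia.
move=> y yj jN.
have jN' : j < N by lia.
have := sp j.+1; rewrite ltnS leqnn => /(_ isT) spj.
have covered z : z <= j ->
    (exists y', hit d2 (j.+1, z) j y') \/ (forall i' y', ~ hit d2 (j.+1, z) i' y').
  move=> zj; case pj: (p j.+1).
  - have rt := all_right jN' cj (etrans spj pj).
    have [->|ne] := eqVneq z j; first by right=> ? ?; apply: top2; rewrite spj.
    by left; exists z; split=> //; [lia | rewrite rt //; lia].
  - have up := all_up jN' cj (negbT pj).
    case: z zj => [|z] zj; first by right=> ? ?; apply: bot2; rewrite pj.
    by left; exists z; split=> //; rewrite up.
have nohit z y' : z <= j -> ~ hit d2 (j.+1, z) j.+1 y'.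
  move=> zj h; have [[y'' h']|/(_ _ _ h)//] := covered _ zj.
  by have [] := inj2 h h'; lia.
case E: (d2 j.+1 y) => //; exfalso.
- by apply: (@nohit y y) => //; split=> //; rewrite E.
- by apply: (@nohit y.-1 y) => //; [lia | split=> //; rewrite E].
Qed.

Lemma hit_below i y i' y' : hit d2 (i.+1, y) i' y' -> clear i.+1 ->
  [/\ i' = i, y' = y, y < i & d2 i y = Rt] \/
  [/\ i' = i, y = y'.+1, y' < i & d2 i y' = Up].
Proof.
case=> yi iN + ci; case E: (d2 i' y') => /= -[] ii yy; subst.
- by have := ci _ yi iN; rewrite E.
- by have := ci _ yi iN; rewrite E.
- by left.
- by right.
Qed.

(** The odd vertices of level [i.+1] can only be entered from level [i], and all but one must be:
    the exception is the top one for the letter 1 and the bottom one for 0. From the opposite end,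
    each of them forces the direction at one even vertex. *)
Lemma clear_pred i : i < N -> clear i.+1 -> s i.+1 = p i.+1 -> clear i.
Proof.
move=> iN ci spi; case pj: (p i.+1); rewrite pj in spi.
- have rt : forall y, y < i -> d2 i y = Rt.
    elim=> [|y IH] yi.
    + have [||||i' [y' /hit_below/(_ ci)[[_ _ _ ->]|[_ + _]]]] // := @cov2 i.+1 0; rewrite ?pj //.
      by case: (i) yi.
    + have [||||i' [y' /hit_below/(_ ci)[[_ _ _ ->]|[_ + _]]]] := @cov2 i.+1 y.+1.
      * lia.
      * lia.
      * by [].
      * by rewrite negb_and; apply/orP; left; lia.
      * by [].
      * by move=> [<-]; rewrite IH //; lia.
  by move=> y yi _; rewrite rt.
- have up : forall k, k < i -> d2 i (i - k.+1) = Up.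
    elim=> [|k IH] ki.
    + have [||||i' [y' /hit_below/(_ ci)[[_ _]|[_ + _]]]] := @cov2 i.+1 i.
      * lia.
      * lia.
      * by rewrite negb_and; apply/orP; left; lia.
      * by rewrite spi andbF.
      * lia.
      * by move=> ->; rewrite subSS subn0.
    + have [||||i' [y' /hit_below/(_ ci)[[_ _ _]|[_ + _]]]] := @cov2 i.+1 (i - k.+1).
      * lia.
      * lia.
      * by rewrite negb_and; apply/orP; left; lia.
      * by rewrite spi andbF.
      * by rewrite IH //; lia.
      * by move=> E; rewrite (_ : i - k.+2 = y') //; lia.
  move=> y yi _; rewrite (_ : y = i - (i - y.+1).+1) ?up //; lia.
Qed.

Lemma clear_suffix j : j <= N ->
  (forall k, j < k <= N -> s k = p k) -> clear j.
Proof.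
move=> jN; have [m mE] : exists m, m = N - j by eexists.
(* The induction starts at [N], where [clear] is vacuous. *)
elim: m j jN mE => [|m IH] j jN mE sp; first by move=> y _; lia.
apply: clear_pred; [lia| |apply: sp; lia].
by apply: IH => [||k hk]; [lia | lia | apply: sp; lia].
Qed.

(** * Edges going back one antidiagonal, near the top and the bottom *)

Definition topgap (i g : nat) : Prop :=
  forall y, y < i -> i <= y + g -> i < N -> ~~ rising (d1 i y).

(** At these lowest vertices a path comes from level [i.+1] and returns to it. *)
Definition botrun (i r : nat) : Prop :=
  r <= i /\ forall y, y < r -> i < N -> rising (d1 i y) /\ rising (d2 i y).

(** The counterpart of [topgap] on the next odd antidiagonal; the two alternate in the induction. *)
Definition untouched (i g : nat) : Prop :=
  forall y y', i.+1 <= y + g -> ~ hit d1 (i.+1, y) i y'.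

(** An edge going back keeps its height or loses one, and the top height drops by one, so the gap
    keeps its size. *)
Lemma topgap_untouched i g : topgap i g -> untouched i g.
Proof.
move=> gi y y' yg []; case E: (d1 i y') => /= yi iN [] //; try lia.
- move=> ?; subst; suff : ~~ rising (d1 i y) by rewrite E.
  by apply: gi => //; lia.
- move=> ?; subst; suff : ~~ rising (d1 i y') by rewrite E.
  by apply: gi => //; lia.
Qed.

(** By [all_up] the leaving edges take every [Up], so edges going back keep their height while the
    top height drops: the gap gains one. *)
Lemma topgap_untouchedS i g : clear i -> ~~ p i.+1 -> topgap i g -> untouched i g.+1.
Proof.
move=> ci pi gi y y' yg []; case E: (d1 i y') => /= yi iN [] //; try lia.
- move=> ?; subst; suff : ~~ rising (d1 i y) by rewrite E.
  by apply: gi => //; lia.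
- by have := d12 yi iN; rewrite E (all_up iN ci pi).
Qed.

(** The odd vertices in the gap must send their edges forward. From the top down, [Lf] at one height
    excludes [Dn] there and thus forces [Lf] just below. The premise on [p] keeps a bottom vertex
    without leaving edge out of the gap. *)
Lemma untouched_topgap i g : (p i.+1 -> g <= i) ->
  untouched i g -> topgap i.+1 g.
Proof.
move=> pg un.
suff lf : forall k, k < g -> k <= i -> i.+1 < N -> d1 i.+1 (i - k) = Lf.
  move=> y yi yg iN; have := lf (i - y).
  by rewrite (_ : i - (i - y) = y); [move=> -> //; lia | lia].
have next k : k < g -> k <= i -> i.+1 < N ->
    (0 < k -> d1 i.+1 (i - k).+1 = Lf) -> d1 i.+1 (i - k) = Lf.
  move=> kg ki iN IH.
  have [||i' [y' h]] := @cov1 i.+1 (i - k) _ iN; first lia.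
    by case pi: (p i.+1); rewrite ?andbF //; have := pg pi; lia.
  have := h => -[]; case E: (d1 i' y') => /= yi iN' [] ii yy; subst.
  - exact: E.
  - case: y' => [|y'] /= in E yi yy h *; first by have := @dn1 i.+1 isT iN; rewrite E.
    by subst; move: E; rewrite IH //; lia.
  - by exfalso; apply: un h; lia.
  - by exfalso; apply: un h; lia.
elim=> [|k IH] kg ki iN; apply: next => // _.
by rewrite -IH; [congr (d1 _ _); lia | lia | lia | ].
Qed.

(** The argument of [all_up] for entering edges: a bottom vertex that closes a pair of the matching
    has no leaving edge. *)
Lemma botrun_up i r : i < N -> p i.+1 -> botrun i r -> forall y, y < r -> d1 i y = Up.
Proof.
move=> iN pi [ri rr]; elim=> [|y IH] yr; have [+ _] := rr _ yr iN.
- case E: (d1 i 0) => // _; exfalso; apply: (@bot1 i.+1 i 0 pi).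
  by split=> //; [lia | rewrite E].
- case E: (d1 i y.+1) => // _; exfalso.
  have [] : i = i /\ y = y.+1; last by lia.
  apply: (@inj1 (i.+1, y.+1)); split=> //; try lia.
  + by rewrite IH //; lia.
  + by rewrite E.
Qed.

Lemma botrun_up2 i r : i < N -> ~~ p i.+1 -> botrun i r -> forall y, y < r -> d2 i y = Up.
Proof.
move=> iN pi [ri rr]; elim=> [|y IH] yr; have [_ +] := rr _ yr iN.
- case E: (d2 i 0) => // _; exfalso; apply: (@bot2 i.+1 i 0 pi).
  by split=> //; [lia | rewrite E].
- case E: (d2 i y.+1) => // _; exfalso.
  have [] : i = i /\ y = y.+1; last by lia.
  apply: (@inj2 (i.+1, y.+1)); split=> //; try lia.
  + by rewrite IH //; lia.
  + by rewrite E.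
Qed.

Lemma rising_blocked (d : nat -> nat -> dir) i r :
  (0 < i -> i < N -> d i 0 <> Dn) ->
  (forall y y', y < r -> ~ hit d (i, y) i y') ->
  forall y, y < r -> y < i -> i < N -> rising (d i y).
Proof.
move=> dn no y yr yi iN; case E: (d i y) => //; exfalso.
- by apply: (@no y y) => //; split=> //; rewrite E.
- case: y => [|y] in yr yi E *; first by apply: dn E.
  by apply: (@no y y.+1); [lia | split=> //; rewrite E].
Qed.

Lemma botrun_step1 i r : p i.+1 -> botrun i r ->
  botrun i.+1 r /\ (clear i.+1 -> botrun i.+1 r.+1).
Proof.
move=> pi br; have [ri rr] := br.
have r1 y : y < r.+1 -> i.+1 < N -> rising (d1 i.+1 y).
  move=> yr iN; apply: (@rising_blocked d1 i.+1 r.+1) => //; [exact: dn1| |lia].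
  move=> {yr}y y' yr; case: y yr => [|y] yr h; first by apply: (@bot1 i.+1 i.+1 y').
  suff /(inj1 h)[] : hit d1 (i.+1, y.+1) i y by lia.
  by split; [lia | lia | rewrite (botrun_up _ pi br) //; lia].
have r2 y : y < r -> i.+1 < N -> rising (d2 i.+1 y).
  move=> yr iN; apply: (@rising_blocked d2 i.+1 r) => //; [exact: dn2| |lia].
  move=> {yr}y y' yr h; have iN' : i < N by lia.
  have yi : y < i by lia.
  have E := botrun_up iN' pi br yr.
  suff /(inj2 h)[] : hit d2 (i.+1, y) i y by lia.
  split=> //; have [_] := rr _ yr iN'.
  by have := d12 yi iN'; rewrite E; case: (d2 i y).
split; first by split=> [|y yr iN]; [lia | split; [apply: r1; lia | exact: r2]].
by move=> ci; split=> [|y yr iN]; [lia | split; [exact: r1 | apply: ci; lia]].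
Qed.

(** The two kinds of edges exchange roles: now the leaving edges are [Up] and the entering ones
    [Rt], which only secures the heights below [r] for the latter. *)
Lemma botrun_step0 i r : ~~ p i.+1 -> botrun i r -> botrun i.+1 r.
Proof.
move=> pi br; have [ri rr] := br.
split=> [|y yr iN]; first lia.
have iN' : i < N by lia.
split.
- apply: (@rising_blocked d1 i.+1 r) => //; [exact: dn1| |lia].
  move=> {yr}y y' yr h; have yi : y < i by lia.
  have E := botrun_up2 iN' pi br yr.
  suff /(inj1 h)[] : hit d1 (i.+1, y) i y by lia.
  split=> //; have [+ _] := rr _ yr iN'.
  by have := d12 yi iN'; rewrite E; case: (d1 i y).
- apply: (@rising_blocked d2 i.+1 r) => //; [exact: dn2| |lia].
  move=> {yr}y y' yr; case: y yr => [|y] yr h; first by apply: (@bot2 i.+1 i.+1 y').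
  suff /(inj2 h)[] : hit d2 (i.+1, y.+1) i y by lia.
  by split; [lia | lia | rewrite (botrun_up2 _ pi br) //; lia].
Qed.

Variable fr : pred nat.
Hypothesis fr_clear : forall i, 0 < i <= N -> fr i -> clear i.-1 /\ clear i.

(** For [c0] this bounds from below the gap at the top, for [c1] the run at the bottom. *)
Definition frozen (c : bool) (i : nat) : nat :=
  count (fun j => fr j && (p j == c)) (iota 1 i).

Lemma frozenS c i : frozen c i.+1 = frozen c i + (fr i.+1 && (p i.+1 == c)).
Proof. by rewrite /frozen -{1}[i.+1]addn1 iotaD count_cat /= addn0 add1n. Qed.

Lemma frozen_leq c i : frozen c i <= i.
Proof. by rewrite -[leqRHS](size_iota 1 i) count_size. Qed.

Lemma frozen_untouched i : i < N -> untouched i (frozen c0 i.+1).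
Proof.
have step j : j < N -> topgap j (frozen c0 j) -> untouched j (frozen c0 j.+1).
  move=> jN g; rewrite frozenS; case E: (_ && _).
  - case/andP: E => f /eqP pj; rewrite addn1; apply: topgap_untouchedS => //.
    + by case: (@fr_clear j.+1).
    + by rewrite pj.
  - by rewrite addn0; apply: topgap_untouched.
move=> iN; apply: (step i iN); elim: i iN => [//|i IH] iN.
apply: untouched_topgap; last by apply: step (IH _); lia.
by move=> pi; rewrite frozenS pi andbF addn0 frozen_leq.
Qed.

Lemma frozen_botrun i : i < N -> botrun i (frozen c1 i).
Proof.
elim: i => [//|i IH] iN; have {IH} br := IH (ltnW iN).
rewrite frozenS; case pi: (p i.+1); last first.
  by rewrite andbF addn0; apply: botrun_step0; rewrite ?pi.
have [br0 br1] := botrun_step1 pi br.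
case f: (fr i.+1); last by rewrite addn0.
by rewrite addn1; apply: br1; case: (@fr_clear i.+1) => //; lia.
Qed.

Lemma frozen_up i y : i < N -> p i.+1 -> y < frozen c1 i -> d1 i y = Up.
Proof. by move=> iN pi; apply: botrun_up => //; apply: frozen_botrun. Qed.

End Levels.

Lemma frozen_affixes c (u m v : word) :
  frozen (letter (u ++ m ++ v))
    (fun j => (j <= size u) || (size u + size m < j)) c (size (u ++ m ++ v)) =
  count_mem c u + count_mem c v.
Proof.
rewrite /frozen !size_cat !iotaD !count_cat addnA; congr (_ + _).
  rewrite -[RHS]addn0; congr (_ + _).
    rewrite -(count_letter c [::] u (m ++ v)); apply: eq_in_count => j.
    by rewrite mem_iota /=; lia.
  apply/eqP; rewrite -leqn0 leqNgt -has_count; apply/hasPn => j.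
  by rewrite mem_iota => hj; rewrite negb_and; apply/orP; left; lia.
rewrite -(count_letter c (u ++ m) v [::]) cats0 -catA size_cat -addSn add1n.
apply: eq_in_count => j; rewrite mem_iota => hj.
by rewrite (_ : (_ || _) = true) //; lia.
Qed.

(** * Degrees in TFPL configurations *)

Local Open Scope fset_scope.
Local Open Scope nat_scope.

Lemma joinedE (f : {fset edge}) (p q : point) : joined f p q =
  [|| (hor p \in f) && (q == (p.1.+1, p.2)), (hor q \in f) && (p == (q.1.+1, q.2)),
      (ver p \in f) && (p == (q.1, q.2.+1)) | (ver q \in f) && (q == (p.1, p.2.+1))].
Proof.
case: p q => [a b] [c d]; rewrite /hor /ver; apply/andP/idP.
- case=> ne /hasP[[[x y]|[x y]] ef]; rewrite /= !xpair_eqE /=.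
  + case/andP=> /orP[]/andP[/eqP ex /eqP ey] /orP[]/andP[/eqP ex' /eqP ey']; subst.
    * by rewrite eqxx in ne.
    * by rewrite ef !eqxx.
    * by rewrite ef !eqxx /= orbT.
    * by rewrite eqxx in ne.
  + case/andP=> /orP[]/andP[/eqP ex /eqP ey] /orP[]/andP[/eqP ex' /eqP ey']; subst.
    * by rewrite eqxx in ne.
    * by rewrite ef !eqxx /= !orbT.
    * by rewrite ef !eqxx /= !orbT.
    * by move: ne; rewrite xpair_eqE /= eqxx -eqSS ey' eqxx.
- case/or4P=> /andP[ef /eqP[? ?]]; subst.
  + split; first by rewrite xpair_eqE; lia.
    by apply/hasP; eexists; first exact: ef; rewrite /= !eqxx /= ?orbT.
  + split; first by rewrite xpair_eqE; lia.
    by apply/hasP; eexists; first exact: ef; rewrite /= !eqxx /= ?orbT.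
  + split; first by rewrite xpair_eqE; lia.
    by apply/hasP; eexists; first exact: ef; rewrite /= !eqxx /= ?orbT.
  + split; first by rewrite xpair_eqE; lia.
    by apply/hasP; eexists; first exact: ef; rewrite /= !eqxx /= ?orbT.
Qed.

Lemma joined_sym f : symmetric (joined f).
Proof. by move=> p q; rewrite /joined eq_sym; congr (_ && _); apply: eq_has => e; rewrite andbC. Qed.

Lemma joined_irr f : irreflexive (joined f).
Proof. by move=> p; rewrite /joined eqxx. Qed.

Lemma degreeE (f : {fset edge}) x y : degree f (x, y) =
  (hor (x, y) \in f) + ((0 < x) && (hor (x.-1, y) \in f)) +
  (ver (x, y) \in f) + (ver (x, y.+1) \in f).
Proof.
(* The guard matters because [x.-1] is [x] when [x] is 0, which would repeat the first edge. *)
pose cand : seq edge := [:: hor (x, y), ver (x, y), ver (x, y.+1) &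
  if 0 < x then [:: hor (x.-1, y)] else [::]].
have ucand : uniq cand.
  by rewrite /cand /hor /ver; case: (x) => [|x']; rewrite /= !inE /eq_op /= !xpair_eqE; lia.
have -> : degree f (x, y) = size [seq e <- cand | e \in f].
  rewrite /degree -(undup_id (filter_uniq (fun e => e \in f) ucand)) -card_fseq.
  congr (#|` _|); apply/fsetP => e; rewrite !inE mem_filter; congr (_ && _).
  rewrite /cand; case: e => -[a b]; case: (x) => [|x'];
    rewrite /= !inE /eq_op /= !xpair_eqE; lia.
rewrite /cand size_filter /=; case: (0 < x) => /=.
- by move: (_ \in f) (_ \in f) (_ \in f) (_ \in f) => *; lia.
- by move: (_ \in f) (_ \in f) (_ \in f) => *; lia.
Qed.

(* The degree without the external edge. *)
Definition inner_degree (f : {fset edge}) (q : point) : nat :=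
  let: (x, y) := q in
  (hor (x, y) \in f) + ((0 < x) && (hor (x.-1, y) \in f)) +
  ((0 < y) && (ver (x, y) \in f)) + (ver (x, y.+1) \in f).

Lemma joined_cases (f : {fset edge}) x y q : joined f (x, y) q ->
  [\/ hor (x, y) \in f /\ q = (x.+1, y),
      [/\ 0 < x, hor (x.-1, y) \in f & q = (x.-1, y)],
      [/\ 0 < y, ver (x, y) \in f & q = (x, y.-1)] |
      ver (x, y.+1) \in f /\ q = (x, y.+1)].
Proof.
rewrite joinedE; case: q => a b /or4P[] /andP[ef /eqP[? ?]]; subst.
- by constructor 1.
- by constructor 2.
- by constructor 3.
- by constructor 4.
Qed.

Lemma inner_degree_gt0 f q p : joined f q p -> 0 < inner_degree f q.
Proof.
case: q => x y /joined_cases[[h _]|[x0 h _]|[y0 h _]|[h _]];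
  by rewrite /inner_degree h ?x0 ?y0; lia.
Qed.

Lemma inner_degree_le1 f q p r : inner_degree f q <= 1 ->
  joined f q p -> joined f q r -> p = r.
Proof.
case: q => x y d /joined_cases[[h ->]|[x0 h ->]|[y0 h ->]|[h ->]]
  /joined_cases[[h' ->]|[x0' h' ->]|[y0' h' ->]|[h' ->]] //;
  by move: d; rewrite /inner_degree h h' ?x0 ?y0 ?x0' ?y0'; lia.
Qed.

Lemma inner_degree_le2 f q p r t : inner_degree f q <= 2 ->
  joined f q p -> joined f q r -> joined f q t -> p <> r -> p <> t -> r = t.
Proof.
case: q => x y d /joined_cases[[h ->]|[x0 h ->]|[y0 h ->]|[h ->]]
  /joined_cases[[h' ->]|[x0' h' ->]|[y0' h' ->]|[h' ->]] //
  /joined_cases[[h'' ->]|[x0'' h'' ->]|[y0'' h'' ->]|[h'' ->]] //;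
  by move: d; rewrite /inner_degree h h' h'' ?x0 ?y0 ?x0' ?y0' ?x0'' ?y0''; lia.
Qed.

Lemma joined_hor (f : {fset edge}) x y : hor (x, y) \in f -> joined f (x, y) (x.+1, y).
Proof. by move=> h; rewrite joinedE h eqxx. Qed.

Lemma joined_ver (f : {fset edge}) x y : ver (x, y.+1) \in f -> joined f (x, y.+1) (x, y).
Proof. by move=> h; rewrite joinedE h eqxx !orbT. Qed.

Lemma inner_degree_ge1 f q : 0 < inner_degree f q -> exists p, joined f q p.
Proof.
case: q => x y; rewrite /inner_degree.
case h1: (hor (x, y) \in f); first by exists (x.+1, y); apply: joined_hor.
case h2: (_ && (hor (x.-1, y) \in f)).
  by case: x h2 {h1} => // x h2; exists (x, y); rewrite joined_sym; apply: joined_hor.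
case h3: (_ && (ver (x, y) \in f)).
  by case: y h3 {h1 h2} => // y h3; exists (x, y); apply: joined_ver.
case h4: (ver _ \in f) => // _.
by exists (x, y.+1); rewrite joined_sym; apply: joined_ver.
Qed.

Lemma inner_degree_ge2 f q : 1 < inner_degree f q ->
  exists p r, [/\ joined f q p, joined f q r & p <> r].
Proof.
case: q => x y; rewrite /inner_degree.
have j1 : hor (x, y) \in f -> joined f (x, y) (x.+1, y) by apply: joined_hor.
have j2 : (0 < x) && (hor (x.-1, y) \in f) -> joined f (x, y) (x.-1, y).
  by case: x {j1} => // x h; rewrite joined_sym; apply: joined_hor.
have j3 : (0 < y) && (ver (x, y) \in f) -> joined f (x, y) (x, y.-1).
  by case: y {j1 j2} => // y h; apply: joined_ver.
have j4 : ver (x, y.+1) \in f -> joined f (x, y) (x, y.+1).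
  by move=> h; rewrite joined_sym; apply: joined_ver.
have ne1 : (x.+1, y) <> (x.-1, y) by case; lia.
have ne2 : (x.+1, y) <> (x, y.-1) by case; lia.
have ne3 : (x.+1, y) <> (x, y.+1) by case; lia.
have ne4 : (x.-1, y) <> (x, y.+1) by case; lia.
have ne5 : (x, y.-1) <> (x, y.+1) by case; lia.
have ne6 : (0 < x) && (hor (x.-1, y) \in f) -> (x.-1, y) <> (x, y.-1).
  by move=> /andP[x0 _] []; lia.
move: j1 j2 j3 j4 ne6.
case: (hor (x, y) \in f); case: ((0 < x) && _); case: ((0 < y) && _);
  case: (ver (x, y.+1) \in f) => // j1 j2 j3 j4 ne6 _;
  first [ by exists (x.+1, y), (x.-1, y); split=> //; auto
        | by exists (x.+1, y), (x, y.-1); split=> //; auto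
        | by exists (x.+1, y), (x, y.+1); split=> //; auto
        | by exists (x.-1, y), (x, y.-1); split=> //; auto
        | by exists (x.-1, y), (x, y.+1); split=> //; auto
        | by exists (x, y.-1), (x, y.+1); split=> //; auto ].
Qed.

Lemma degree_inner (f : {fset edge}) x y :
  degree f (x, y) = inner_degree f (x, y) + ((y == 0) && (ver (x, y) \in f)).
Proof. by rewrite degreeE /inner_degree; case: y => [|y] /=; rewrite ?addn0 // addnAC. Qed.

(** * Coordinates along the antidiagonals *)

Definition od (i y : nat) : point := (2 * i - 2 - y, y).
Definition ev (i y : nat) : point := (2 * i - 1 - y, y).

Definition odp (o : nat * nat) : point := od o.1 o.2.

(** [Up] is a default value, correct as soon as [r] relates the vertex to one of its neighbours in
    [f]. The guard on [Dn] excludes height 0, where [y.-1] is not below [y]. *)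
Definition dirof (r : rel point) (i y : nat) : dir :=
  if r (ev i y) (od i y) then Lf else
  if (0 < y) && r (ev i y) (od i y.-1) then Dn else
  if r (ev i y) (od i.+1 y) then Rt else Up.

Lemma dirof_Dn r i : dirof r i 0 <> Dn.
Proof. by rewrite /dirof /=; case: ifP => // _; case: ifP. Qed.

Lemma ev_nbr f i y q : y < i -> joined f (ev i y) q ->
  [\/ q = od i y, 0 < y /\ q = od i y.-1, q = od i.+1 y | q = od i.+1 y.+1].
Proof.
rewrite /ev /od => yi /joined_cases[[_ ->]|[x0 _ ->]|[y0 _ ->]|[_ ->]].
- by constructor 3; congr pair; lia.
- by constructor 1; congr pair; lia.
- by constructor 2; split=> //; congr pair; lia.
- by constructor 4; congr pair; lia.
Qed.

Lemma dirofP f (r : rel point) i y q : y < i ->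
  (forall q, r (ev i y) q -> joined f (ev i y) q) ->
  r (ev i y) q -> r (ev i y) (odp (target i y (dirof r i y))).
Proof.
move=> yi sub rq; rewrite /dirof; case: ifP => [//|/negP n1].
case: ifP => [/andP[]//|/negP n2]; case: ifP => [//|/negP n3].
have [E|[y0 E]|E|E] := ev_nbr yi (sub _ rq); rewrite E in rq => //.
by case: n2; rewrite y0.
Qed.

Lemma od_inj i y i' y' : y < i -> y' < i' -> od i y = od i' y' -> i = i' /\ y = y'.
Proof. by rewrite /od => ? ? []; lia. Qed.

Lemma ev_inj i y i' y' : y < i -> y' < i' -> ev i y = ev i' y' -> i = i' /\ y = y'.
Proof. by rewrite /ev => ? ? []; lia. Qed.

Lemma odp_inj o o' : o.2 < o.1 -> o'.2 < o'.1 -> odp o = odp o' -> o = o'.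
Proof. by case: o o' => i y [i' y'] /= h h' /(od_inj h h')[-> ->]. Qed.

Lemma target_range i y d : y < i -> (target i y d).2 < (target i y d).1.
Proof. by case: d => /=; lia. Qed.

(** * Boundary conditions of a TFPL configuration *)

Section Tfpl.

Variables (n : nat) (sigma tau pi : word) (f : {fset edge}).
Hypothesis n0 : 0 < n.
Hypotheses (hpi : pi \in dyck n) (hsigma : sigma \in dyck n) (htau : tau \in dyck n).
Hypothesis f_edge : forall e, e \in f -> is_edge n e.
Hypothesis H : tfpl n sigma tau pi f.

Lemma hor_in x y : hor (x, y) \in f -> y <= x /\ x + y < 4 * n - 2.
Proof. by move/f_edge; rewrite /= /in_triangle /=; lia. Qed.

Lemma ver_in x y : ver (x, y.+1) \in f -> y < x /\ x + y < 4 * n - 2.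
Proof. by move/f_edge; rewrite /= /in_triangle /=; lia. Qed.

Lemma ver0_in x : ver (x, 0) \in f -> exists2 i, 0 < i <= 2 * n & x = 2 * i - 2.
Proof.
by move/f_edge => /= /mapP[i]; rewrite mem_iota => hi [->]; exists i => //; lia.
Qed.

Lemma external_in i : 0 < i <= 2 * n -> ver (od i 0) \in f.
Proof. by move=> hi; rewrite /od subn0; apply: (tfpl_external H). Qed.

Lemma interior_degree x y : y < x -> x + y < 4 * n - 2 -> degree f (x, y) = 2.
Proof.
move=> yx xy; apply: (tfpl_degree H); first by rewrite /in_triangle /=; lia.
by move=> i hi; rewrite /L /R; split; case; lia.
Qed.

Lemma inner_ev i y : y < i -> i < 2 * n -> inner_degree f (ev i y) = 2.
Proof.
move=> yi iN; have := @interior_degree (2 * i - 1 - y) y.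
rewrite degree_inner -/(ev i y); case: eqP => [y0|_]; last by rewrite addn0 => ->; lia.
(* External edges hang below even abscissas, while that of [ev i 0] is odd. *)
case E: (ver _ \in f); last by rewrite addn0 => ->; lia.
by move: E; rewrite y0 /ev => /ver0_in[j]; lia.
Qed.

Lemma inner_od_mid i y : 0 < y -> y.+1 < i -> i < 2 * n -> inner_degree f (od i y) = 2.
Proof.
move=> y0 yi iN; have := @interior_degree (2 * i - 2 - y) y.
by rewrite degree_inner -/(od i y) (gtn_eqF y0) addn0 => ->; lia.
Qed.

Lemma inner_od_bottom i : 1 < i < 2 * n -> inner_degree f (od i 0) = 1.
Proof.
move=> hi; have := @interior_degree (2 * i - 2 - 0) 0.
rewrite degree_inner -/(od i 0) external_in; last lia.
by move=> h; apply: succn_inj; rewrite -addn1; apply: h; lia.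
Qed.

(** The vertical edge below [L 1] is external, hence the condition [1 < i]. *)
Lemma inner_od_top i : 0 < i < 2 * n ->
  inner_degree f (od i i.-1) = 1 + ((1 < i) && (letter sigma i == c0)).
Proof.
move=> hi; have E : od i i.-1 = (i - 1, i - 1) by rewrite /od; congr pair; lia.
have hh : hor (i - 1, i - 1) \in f by apply: (tfpl_left_hor H); lia.
rewrite E /inner_degree hh.
have -> : (0 < i - 1) && (hor ((i - 1).-1, i - 1) \in f) = false.
  by apply/negP => /andP[i0 /hor_in]; lia.
have -> : (ver (i - 1, (i - 1).+1) \in f) = false by apply/negP => /ver_in; lia.
rewrite !addn0; congr (_ + nat_of_bool _); rewrite subn_gt0.
case i1: (1 < i) => //=; have h : 2 <= i <= 2 * n by lia.
have [a b] := tfpl_left_ver H h.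
by apply/idP/eqP.
Qed.

(** The triangle has only a vertical edge at the apex, and the last letter 1 of [sigma] removes
    it. *)
Lemma inner_apex : inner_degree f (od (2 * n) (2 * n).-1) = 0.
Proof.
have E : od (2 * n) (2 * n).-1 = (2 * n - 1, 2 * n - 1) by rewrite /od; congr pair; lia.
rewrite E /inner_degree.
have -> : (hor (2 * n - 1, 2 * n - 1) \in f) = false by apply/negP => /hor_in; lia.
have -> : (0 < 2 * n - 1) && (hor ((2 * n - 1).-1, 2 * n - 1) \in f) = false.
  by apply/negP => /andP[i0 /hor_in]; lia.
have -> : (ver (2 * n - 1, (2 * n - 1).+1) \in f) = false by apply/negP => /ver_in; lia.
have -> : (ver (2 * n - 1, 2 * n - 1) \in f) = false; last by rewrite andbF.
apply/negP => v; have h : 2 <= 2 * n <= 2 * n by lia.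
by have [/(_ v)] := tfpl_left_ver H h; rewrite (dyck_last hsigma n0).
Qed.

Lemma inner_right j : 1 < j <= 2 * n ->
  inner_degree f (od (2 * n) (2 * n - j)) = 1 + ((j < 2 * n) && (letter tau j == c1)).
Proof.
move=> hj; have E : od (2 * n) (2 * n - j) = (2 * n - 2 + j, 2 * n - j).
  by rewrite /od; congr pair; lia.
have hh : hor ((2 * n - 2 + j).-1, 2 * n - j) \in f.
  by rewrite -subn1; apply: (tfpl_right_hor H); lia.
rewrite E /inner_degree hh.
have -> : (hor (2 * n - 2 + j, 2 * n - j) \in f) = false by apply/negP => /hor_in; lia.
have -> : (ver (2 * n - 2 + j, (2 * n - j).+1) \in f) = false by apply/negP => /ver_in; lia.
rewrite (_ : 0 < 2 * n - 2 + j); last lia.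
rewrite !addn0 add0n; congr (_ + nat_of_bool _); rewrite subn_gt0.
case j1: (j < 2 * n) => //=; have h : 1 <= j <= 2 * n - 1 by lia.
have [a b] := tfpl_right_ver H h.
by apply/idP/eqP.
Qed.

Lemma joined_in x y q : joined f (x, y) q -> y <= x /\ x + y <= 4 * n - 2.
Proof.
case/joined_cases=> [[/hor_in]|[x0 /hor_in]|[y0 h]|[/ver_in]]; try lia.
by case: y y0 h => // y _ /ver_in; lia.
Qed.

Lemma inner_le2 q : inner_degree f q <= 2.
Proof.
case: q => x y; have [->//|] := posnP (inner_degree f (x, y)).
case/inner_degree_ge1=> p /joined_in[yx xy].
have [ne|] := altP (x =P y).
  subst y; have [lt|ge] := ltnP x.+1 (2 * n).
    have := @inner_od_top x.+1; rewrite (_ : od _ _ = (x, x)); last first.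
      by rewrite /od; congr pair; lia.
    by move=> ->; lia.
  rewrite (_ : (x, x) = od (2 * n) (2 * n).-1) ?inner_apex //.
  by rewrite /od; congr pair; lia.
move=> ne; have [E|ne'] := altP (x + y =P 4 * n - 2).
  have := @inner_right (2 * n - y); rewrite (_ : od _ _ = (x, y)); last first.
    by rewrite /od; congr pair; lia.
  by move=> ->; lia.
by have := @interior_degree x y; rewrite degree_inner; lia.
Qed.

(** The bounds [i < 2 * n] here and [1 < i] in [snk] leave out the apex, whose one-vertex path would
    make it both a source and a sink. *)
Definition src (v : point) : Prop := exists i,
  [/\ 0 < i <= 2 * n, letter pi i = c0 & v = od i 0] \/
  [/\ 0 < i < 2 * n, letter sigma i = c1 & v = od i i.-1].

Definition snk (v : point) : Prop := exists i,
  [/\ 0 < i <= 2 * n, letter pi i = c1 & v = od i 0] \/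
  [/\ 1 < i <= 2 * n, letter tau i = c0 & v = od (2 * n) (2 * n - i)].

Lemma inner_bottom_le1 i : 0 < i <= 2 * n -> inner_degree f (od i 0) <= 1.
Proof.
move=> hi; have [E|ne] := eqVneq i 1; first by rewrite E (inner_od_top (i := 1)) //; lia.
have [E|ne'] := eqVneq i (2 * n); last by rewrite inner_od_bottom //; lia.
have := @inner_right i; rewrite -E subnn => ->; last lia.
by rewrite ltnn.
Qed.

Lemma end_deg1 v p q : src v \/ snk v -> joined f v p -> joined f v q -> p = q.
Proof.
move=> sv; apply: inner_degree_le1; case: sv => -[i [[hi li ->]|[hi li ->]]].
- exact: inner_bottom_le1.
- by rewrite inner_od_top // li andbF.
- exact: inner_bottom_le1.
- by rewrite inner_right // li andbF.
Qed.

(** The boundary sides meet at two bottom corners: [L 1] is [B 1], where [sigma] has the letter 0,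
    and [R n (2 * n)] is [B (2 * n)], where [tau] has the letter 1. *)
Lemma src_snk v : src v -> snk v -> False.
Proof.
have s1 := dyck_first hsigma n0; have t1 := dyck_last htau n0.
case=> i [[hi li ->]|[hi li ->]] [j [[hj lj E]|[hj lj E]]].
- have [ij _] : i = j /\ 0 = 0 by apply: od_inj E; lia.
  by rewrite ij lj in li.
- have [ij jn] : i = 2 * n /\ 0 = 2 * n - j by apply: od_inj E; lia.
  have E' : j = 2 * n by lia.
  by rewrite E' t1 in lj.
- have [ij i1] : i = j /\ i.-1 = 0 by apply: od_inj E; lia.
  have E' : i = 1 by lia.
  by rewrite E' s1 in li.
- by have [] : i = 2 * n /\ i.-1 = 2 * n - j; [apply: od_inj E | ]; lia.
Qed.

Lemma no_nbr_apex p : joined f (od (2 * n) (2 * n).-1) p -> False.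
Proof. by move/inner_degree_gt0; rewrite inner_apex. Qed.

Lemma mem_positions c w i :
  (i \in positions n c w) = (letter w i == c) && (0 < i <= 2 * n).
Proof. by rewrite mem_filter mem_iota add1n ltnS. Qed.

Lemma BE i : B i = od i 0. Proof. by rewrite /B /od subn0. Qed.

Lemma LE i : L i = od i i.-1.
Proof. by rewrite /L /od; congr pair; lia. Qed.

Lemma RE j : 0 < j <= 2 * n -> R n j = od (2 * n) (2 * n - j).
Proof. by move=> hj; rewrite /R /od; congr pair; lia. Qed.

Lemma src_linked v : src v -> exists2 w, snk w & simple_path (joined f) v w.
Proof.
case=> i [[hi li ->]|[hi li ->]].
- have [j [ij jn lj m]] := dyck_close hpi hi li.
  exists (od j 0); first by exists j; left; split=> //; lia.
  by rewrite -!BE; apply/(tfpl_bottom H) => //; lia.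
- have [r [pr lr]] := tfpl_match H.
  have ip : i \in positions n c1 sigma by rewrite mem_positions li eqxx; lia.
  have := map_f r ip; rewrite (perm_mem pr) mem_positions => /andP[/eqP lj hj].
  have := lr i ip; rewrite LE RE // => l.
  exists (od (2 * n) (2 * n - r i)) => //; exists (r i); right; split=> //.
  (* A path that ends at the isolated apex is a single vertex, which would force [i = 2 * n]. *)
  suff : r i <> 1 by lia.
  move=> r1; case: l => s [ps ls _]; case/lastP: s ps ls => [_ E|s z].
    by have [] : i = 2 * n /\ i.-1 = 2 * n - r i; [apply: od_inj E | ]; lia.
  rewrite rcons_path last_rcons => /andP[_ a] E; apply: (@no_nbr_apex (last (od i i.-1) s)).
  by rewrite joined_sym (_ : (2 * n).-1 = 2 * n - r i) -?E //; lia.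
Qed.

Lemma snk_linked w : snk w -> exists2 v, src v & simple_path (joined f) v w.
Proof.
case=> j [[hj lj ->]|[hj lj ->]].
- have [i [i0 ij li m]] := dyck_open hpi hj lj.
  exists (od i 0); first by exists i; left; split=> //; lia.
  by rewrite -!BE; apply/(tfpl_bottom H) => //; lia.
- have [r [pr lr]] := tfpl_match H.
  have : j \in positions n c0 tau by rewrite mem_positions lj eqxx; lia.
  rewrite -(perm_mem pr) => /mapP[i ip rij]; have := lr i ip.
  rewrite -rij LE RE; last lia.
  move: ip; rewrite mem_positions => /andP[/eqP li hi] l.
  exists (od i i.-1) => //; exists i; right; split=> //.
  suff : i <> 2 * n by lia.
  move=> i2; case: l => -[|z s] [/= ps ls _]; last first.
    by case/andP: ps => a _; apply: (@no_nbr_apex z); rewrite -i2.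
  by have [] : i = 2 * n /\ i.-1 = 2 * n - j; [apply: od_inj ls | ]; lia.
Qed.

(** * The oriented configuration *)

Definition ort : rel point := orient (joined f) src.

Lemma ort_joined p q : ort p q -> joined f p q.
Proof. exact: orient_adj. Qed.

Lemma ort_rv p q : joined f p q -> ort q p = ~~ ort p q.
Proof.
apply: orient_rv; [exact: joined_sym | exact: joined_irr | | exact: end_deg1
  | exact: src_snk | exact: src_linked].
by move=> v p' r t; apply: inner_degree_le2; apply: inner_le2.
Qed.

Lemma ort_thru p q r : joined f p q -> joined f q r -> p <> r -> ort p q = ort q r.
Proof.
apply: orient_step; [exact: joined_sym | | exact: end_deg1].
by move=> v p' r' t; apply: inner_degree_le2; apply: inner_le2.
Qed.

Lemma ort_src v p : src v -> joined f v p -> ort v p.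
Proof. exact: orient_src. Qed.

Lemma ort_snk w p : snk w -> joined f p w -> ort p w.
Proof.
by apply: orient_snk; [exact: joined_sym | exact: end_deg1 | exact: src_snk | exact: snk_linked].
Qed.

Lemma ort_asym p q : ort p q -> ort q p -> False.
Proof. by move=> o; rewrite (ort_rv (ort_joined o)) o. Qed.

(** By [ort_thru], of two distinct edges at [v] one enters and the other leaves. *)
Lemma out_uniq v p q : ort v p -> ort v q -> p = q.
Proof.
move=> op oq; have jp := ort_joined op; have jq := ort_joined oq.
have [//|/eqP ne] := eqVneq p q; have := ort_thru _ jq ne.
by rewrite joined_sym (ort_rv jp) op oq => /(_ jp).
Qed.

Lemma in_uniq v p q : ort p v -> ort q v -> p = q.
Proof.
move=> op oq; have jp := ort_joined op; have jq := ort_joined oq.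
have [//|/eqP ne] := eqVneq p q; have := ort_thru jp _ ne.
by rewrite joined_sym (ort_rv jq) op oq => /(_ jq).
Qed.

Lemma inner2_in_out v : inner_degree f v = 2 ->
  (exists p, ort p v) /\ (exists p, ort v p).
Proof.
move=> d; have := @inner_degree_ge2 f v; rewrite d => /(_ isT)[p [r [jp jr ne]]].
have jp' := jp; rewrite joined_sym in jp'.
have := ort_thru jp' jr ne; case E: (ort p v) => E'.
- by split; [exists p | exists r].
- by split; [exists r; rewrite (ort_rv jr) -E' | exists p; rewrite (ort_rv jp') E].
Qed.

Definition d2 : nat -> nat -> dir := dirof ort.
Definition d1 : nat -> nat -> dir := dirof (fun p q => ort q p).

Lemma d2P i y : y < i -> i < 2 * n -> ort (ev i y) (odp (target i y (d2 i y))).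
Proof.
move=> yi iN; have [_ [p op]] := inner2_in_out (inner_ev yi iN).
by apply: (dirofP (f := f) (q := p)) => // q; apply: ort_joined.
Qed.

Lemma d1P i y : y < i -> i < 2 * n -> ort (odp (target i y (d1 i y))) (ev i y).
Proof.
move=> yi iN; have [[p op] _] := inner2_in_out (inner_ev yi iN).
apply: (dirofP (f := f) (r := fun p q => ort q p) (q := p)) => // q.
by rewrite joined_sym; apply: ort_joined.
Qed.

Lemma od_nbr i y q : y < i -> joined f (od i y) q ->
  exists i' y', [/\ y' < i', i' < 2 * n & q = ev i' y'].
Proof.
rewrite /ev /od => yi /joined_cases[[h ->]|[x0 h ->]|[y0 h ->]|[h ->]].
- by have := hor_in h; exists i, y; split; [lia | lia | congr pair; lia].
- by have := hor_in h; exists i.-1, y; split; [lia | lia | congr pair; lia].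
- exists i.-1, y.-1; case: y yi y0 h => // y yi _ /ver_in h.
  by split; [lia | lia | congr pair; lia].
- by have := ver_in h; exists i, y.+1; split; [lia | lia | congr pair; lia].
Qed.

Lemma hit2_ort o i y : hit (2 * n) d2 o i y -> ort (ev i y) (odp o).
Proof. by case=> yi iN <-; apply: d2P. Qed.

Lemma hit1_ort o i y : hit (2 * n) d1 o i y -> ort (odp o) (ev i y).
Proof. by case=> yi iN <-; apply: d1P. Qed.

Lemma ort_hit2 i y p : y < i -> ort p (od i y) ->
  exists i' y', hit (2 * n) d2 (i, y) i' y'.
Proof.
move=> yi o; have := ort_joined o; rewrite joined_sym => /(od_nbr yi)[i' [y' [yi' iN' E]]].
exists i', y'; split=> //; apply: odp_inj; [exact: target_range | by [] |].
by apply: out_uniq (d2P yi' iN') _; rewrite -E.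
Qed.

Lemma ort_hit1 i y p : y < i -> ort (od i y) p ->
  exists i' y', hit (2 * n) d1 (i, y) i' y'.
Proof.
move=> yi o; have := ort_joined o; move=> /(od_nbr yi)[i' [y' [yi' iN' E]]].
exists i', y'; split=> //; apply: odp_inj; [exact: target_range | by [] |].
by apply: in_uniq (d1P yi' iN') _; rewrite -E.
Qed.

Lemma hit2_inj o i y i' y' : hit (2 * n) d2 o i y -> hit (2 * n) d2 o i' y' ->
  i = i' /\ y = y'.
Proof.
move=> h h'; apply: ev_inj; [by case: h | by case: h' |].
exact: in_uniq (hit2_ort h) (hit2_ort h').
Qed.

Lemma hit1_inj o i y i' y' : hit (2 * n) d1 o i y -> hit (2 * n) d1 o i' y' ->
  i = i' /\ y = y'.
Proof.
move=> h h'; apply: ev_inj; [by case: h | by case: h' |].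
exact: out_uniq (hit1_ort h) (hit1_ort h').
Qed.

Lemma d1_neq_d2 i y : y < i -> i < 2 * n -> d1 i y <> d2 i y.
Proof.
by move=> yi iN E; apply: ort_asym (d1P yi iN) _; rewrite E; apply: d2P.
Qed.

(** Where the inner degree is two, one of the two edges enters. The remaining vertices are sinks
    with one inner edge, which must enter. *)
Lemma in_exists i y : y < i -> i <= 2 * n -> ~~ ((y == 0) && ~~ letter pi i) ->
  ~~ ((y.+1 == i) && letter sigma i) -> exists p, ort p (od i y).
Proof.
move=> yi iN b t.
have [y0|ynz] := posnP y.
  move: b; rewrite y0 /= negbK => pi1.
  have i1 : i <> 1 by move=> i1; rewrite i1 (dyck_first hpi n0) in pi1.
  have [p jp] : exists p, joined f (od i 0) p.
    apply: inner_degree_ge1; have [E|ne] := eqVneq i (2 * n); last first.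
      by rewrite inner_od_bottom //; lia.
    by have := @inner_right i; rewrite -E subnn => ->; lia.
  exists p; apply: ort_snk; last by rewrite joined_sym.
  by exists i; left; split=> //; lia.
have [top|ntop] := eqVneq y.+1 i.
  move: t; rewrite top eqxx /= => si.
  have iN' : i <> 2 * n by move=> E; rewrite E (dyck_last hsigma n0) in si.
  have := @inner_od_top i; rewrite (_ : i.-1 = y); last lia.
  rewrite (negbTE si) (_ : 1 < i); last lia.
  by move=> d; apply: (proj1 (inner2_in_out _)); apply: d; lia.
have [E|ne] := eqVneq i (2 * n); last first.
  by apply: (proj1 (inner2_in_out _)); apply: inner_od_mid; lia.
rewrite E; have tE : 2 * n - (2 * n - y) = y by lia.
have := @inner_right (2 * n - y); rewrite tE.
have [tj|tj] := letter_cases tau (2 * n - y); rewrite tj => d.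
- have [p jp] : exists p, joined f (od (2 * n) y) p.
    by apply: inner_degree_ge1; rewrite d //; lia.
  exists p; apply: ort_snk; last by rewrite joined_sym.
  by exists (2 * n - y); right; split=> //; [lia | rewrite tE].
- by apply: (proj1 (inner2_in_out _)); rewrite d; lia.
Qed.

Lemma out_exists i y : y < i -> i < 2 * n -> ~~ ((y == 0) && letter pi i) ->
  exists p, ort (od i y) p.
Proof.
move=> yi iN b.
have [y0|ynz] := posnP y.
  move: b; rewrite y0 /= => /negbTE pi0.
  have [p jp] : exists p, joined f (od i 0) p.
    apply: inner_degree_ge1; have [E|ne] := eqVneq i 1; last first.
      by rewrite inner_od_bottom //; lia.
    by rewrite E (inner_od_top (i := 1)) //; lia.
  by exists p; apply: ort_src => //; exists i; left; split=> //; lia.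
have [top|ntop] := eqVneq y.+1 i; last first.
  by apply: (proj2 (inner2_in_out _)); apply: inner_od_mid; lia.
have := @inner_od_top i; rewrite (_ : i.-1 = y); last lia.
have [si|si] := letter_cases sigma i; rewrite si => d.
- by apply: (proj2 (inner2_in_out _)); rewrite d; lia.
- have [p jp] : exists p, joined f (od i y) p.
    by apply: inner_degree_ge1; rewrite d //; lia.
  by exists p; apply: ort_src => //; exists i; right; split=> //; [lia | congr od; lia].
Qed.

Lemma right_out k : 0 < k < 2 * n -> letter tau k = c1 ->
  exists p, ort (od (2 * n) (2 * n - k)) p.
Proof.
move=> hk tk; have k1 : k <> 1 by move=> E; rewrite E (dyck_first htau n0) in tk.
by apply: (proj2 (inner2_in_out _)); rewrite inner_right ?tk; lia.
Qed.

Lemma in_bottom i p : 0 < i <= 2 * n -> letter pi i = c0 -> ~ ort p (od i 0).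
Proof.
move=> hi li o; apply: (ort_asym o); apply: ort_src.
  by exists i; left.
by rewrite joined_sym; apply: ort_joined.
Qed.

Lemma out_bottom i p : 0 < i <= 2 * n -> letter pi i = c1 -> ~ ort (od i 0) p.
Proof.
move=> hi li o; apply: (ort_asym o); apply: ort_snk.
  by exists i; left.
by rewrite joined_sym; apply: ort_joined.
Qed.

Lemma in_top i p : 0 < i <= 2 * n -> letter sigma i = c1 -> ~ ort p (od i i.-1).
Proof.
move=> hi li o; have [E|ne] := eqVneq i (2 * n).
  by apply: (@no_nbr_apex p); rewrite -E joined_sym; apply: ort_joined.
apply: (ort_asym o); apply: ort_src.
  by exists i; right; split=> //; lia.
by rewrite joined_sym; apply: ort_joined.
Qed.

Lemma hit_range d i y i' y' : hit (2 * n) d (i, y) i' y' -> 0 < i <= 2 * n.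
Proof. by case=> yi iN; case: (d i' y') => -[]; lia. Qed.

(** From the last even antidiagonal, [Up] is the vertical edge just below the right boundary vertex
    of index [(2 * n).-1 - y]. *)
Lemma right_edge y : y < (2 * n).-1 -> d1 (2 * n).-1 y = Up ->
  letter tau ((2 * n).-1 - y) = c1.
Proof.
move=> hy E; have N0 : (2 * n).-1.+1 = 2 * n by lia.
have lt : (2 * n).-1 < 2 * n by lia.
have /ort_joined := d1P hy lt; rewrite E /odp /= N0 /od /ev.
case/joined_cases=> [[_ []]|[_ _ []]|[_ v _]|[_ []]]; try lia.
have h : 1 <= (2 * n).-1 - y <= 2 * n - 1 by lia.
apply/(tfpl_right_ver H h); move: v; congr (is_true (ver _ \in f)).
by rewrite /R; congr pair; lia.
Qed.

(** The gap is read on the odd level [2 * n], the run on the even level [(2 * n).-1], which explains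
    the two bounds in [frozen]. A letter 1 of [tau] in the gap would give an edge going back; the
    run consists of vertical edges at the right boundary. *)
Lemma frozen_tau (fr : pred nat) :
  (forall i, 0 < i <= 2 * n -> fr i ->
    (forall k, 0 < k <= i -> letter sigma k = letter pi k) \/
    (forall k, i <= k <= 2 * n -> letter sigma k = letter pi k)) ->
  (forall k, 0 < k < 2 * n -> k <= frozen (letter pi) fr c0 (2 * n) ->
     letter tau k = c0) /\
  (forall k, 2 * n <= k + frozen (letter pi) fr c1 (2 * n).-1 -> k < 2 * n ->
     letter tau k = c1).
Proof.
move=> hfr.
have dn1 i : 0 < i -> i < 2 * n -> d1 i 0 <> Dn by move=> _ _; apply: dirof_Dn.
have dn2 i : 0 < i -> i < 2 * n -> d2 i 0 <> Dn by move=> _ _; apply: dirof_Dn.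
have cov1 i y : y < i -> i < 2 * n -> ~~ ((y == 0) && letter pi i) ->
    exists i' y', hit (2 * n) d1 (i, y) i' y'.
  by move=> yi iN b; have [p o] := out_exists yi iN b; apply: ort_hit1 o.
have cov2 i y : y < i -> i <= 2 * n -> ~~ ((y == 0) && ~~ letter pi i) ->
    ~~ ((y.+1 == i) && letter sigma i) -> exists i' y', hit (2 * n) d2 (i, y) i' y'.
  by move=> yi iN b t; have [p o] := in_exists yi iN b t; apply: ort_hit2 o.
have bot1 i i' y' : letter pi i -> ~ hit (2 * n) d1 (i, 0) i' y'.
  by move=> pi1 h; apply: (out_bottom (hit_range h) pi1 (hit1_ort h)).
have bot2 i i' y' : ~~ letter pi i -> ~ hit (2 * n) d2 (i, 0) i' y'.
  by move=> /negbTE pi0 h; apply: (in_bottom (hit_range h) pi0 (hit2_ort h)).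
have top2 i i' y' : letter sigma i.+1 -> ~ hit (2 * n) d2 (i.+1, i) i' y'.
  by move=> s1 h; apply: (in_top (hit_range h) s1 (hit2_ort h)).
have clr i : 0 < i <= 2 * n -> fr i -> clear (2 * n) d2 i.-1 /\ clear (2 * n) d2 i.
  move=> hi /(hfr i hi)[pre|suf]; split.
  - by apply: (clear_prefix hit2_inj bot2 top2) => k hk; apply: pre; lia.
  - by apply: (clear_prefix hit2_inj bot2 top2) => k hk; apply: pre; lia.
  - by apply: (clear_suffix cov2); [lia|] => k hk; apply: suf; lia.
  - by apply: (clear_suffix cov2); [lia|] => k hk; apply: suf; lia.
have lt : (2 * n).-1 < 2 * n by lia.
have N0 : (2 * n).-1.+1 = 2 * n by lia.
split=> k.
- move=> hk; have [//|tk] := letter_cases tau k.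
  have [p o] := right_out hk tk.
  have yN : 2 * n - k < 2 * n by lia.
  have [i' [y' h]] := ort_hit1 yN o.
  have un := frozen_untouched hit2_inj d1_neq_d2 dn1 cov1 bot2 clr lt.
  rewrite N0 in un => hg.
  (* The vertex [R n k] has height [2 * n - k], so the first letters of [tau] belong to the top of
     the gap. *)
  case: (un (2 * n - k) y'); first by rewrite /c0 in hg *; lia.
  have i'E : i' = (2 * n).-1.
    by case: h => _ iN'; case: (d1 i' y') => -[]; lia.
  by rewrite N0 -i'E.
- move=> hg kN; pose y := (2 * n).-1 - k.
  have yg : y < frozen (letter pi) fr c1 (2 * n).-1 by rewrite /y; lia.
  have := frozen_leq (letter pi) fr c1 (2 * n).-1 => le.
  have := @right_edge y; rewrite (_ : (2 * n).-1 - y = k); last by rewrite /y; lia.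
  apply; first lia.
  apply: (frozen_up hit1_inj hit2_inj d1_neq_d2 dn1 dn2 bot1 bot2 clr) yg => //.
  by rewrite N0 (dyck_last hpi n0).
Qed.

End Tfpl.

(** * From common prefixes and suffixes to the shape of [tau] *)

Theorem theorem4p6 (n : nat) (pi sigma tau : word)
  (hn : 1 <= n)
  (hpi : pi \in dyck n) (hsigma : sigma \in dyck n) (htau : tau \in dyck n)
  (u sigma' pi' v : word)
  (sigmaE : sigma = u ++ sigma' ++ v) (piE : pi = u ++ pi' ++ v)
  (a b : nat) (ha : a <= n) (hb : b <= n)
  (aE : n - a = zeros u + zeros v) (bE : n - b = ones u + ones v) :
  ~ (exists tau' : word,
       tau = nseq (n - a) c0 ++ tau' ++ nseq (n - b) c1) ->
  tfpl_count n sigma tau pi = 0.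
Proof.
move=> no; apply/eqP; rewrite cardfs_eq0; apply/eqP/fsetP => f; rewrite !inE.
apply/negP => /andP[ff /asboolP H]; apply: no.
have f_edge e : e \in f -> is_edge n e.
  by move=> ef; move: ff; rewrite fpowersetE => /fsubsetP/(_ e ef); rewrite !inE => /andP[].
have [ss zs os _] := dyckP hsigma; have [sp zp op _] := dyckP hpi.
have [st zt ot _] := dyckP htau.
have m : size sigma' = size pi'.
  by move: ss sp; rewrite sigmaE piE !size_cat; lia.
have sN : 2 * n = size u + size pi' + size v by rewrite -sp piE !size_cat; lia.
pose fr j := (j <= size u) || (size u + size pi' < j).
have hfr i : 0 < i <= 2 * n -> fr i ->
    (forall k, 0 < k <= i -> letter sigma k = letter pi k) \/
    (forall k, i <= k <= 2 * n -> letter sigma k = letter pi k).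
  move=> hi /orP[iu|iv]; [left|right] => k hk; rewrite sigmaE piE /letter !nth_cat.
    by rewrite (_ : k.-1 < size u) //; lia.
  rewrite (_ : k.-1 < size u = false); last lia.
  by rewrite m (_ : k.-1 - size u < size pi' = false) //; lia.
have frz c : frozen (letter pi) fr c (2 * n) = count_mem c u + count_mem c v.
  by rewrite -sp piE frozen_affixes.
have [t0 t1] := frozen_tau hn hpi hsigma htau f_edge H hfr.
have f0 : frozen (letter pi) fr c0 (2 * n) = n - a by rewrite frz aE.
(* Level [2 * n] may itself be frozen, but the run only counts the levels before it. The letter that
   may be missing is the last one of [tau], which is 1 because [tau] is a Dyck word. *)
have f1 : n - b <= (frozen (letter pi) fr c1 (2 * n).-1).+1.
  have := frozenS (letter pi) fr c1 (2 * n).-1.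
  rewrite (_ : (2 * n).-1.+1 = 2 * n); last lia.
  by rewrite frz -[_ + _]/(ones u + ones v) -bE => ->; case: (_ && _); lia.
rewrite f0 in t0.
have ab : (n - a) + (n - b) <= 2 * n by lia.
exists (take (2 * n - (n - a) - (n - b)) (drop (n - a) tau)).
have pre : take (n - a) tau = nseq (n - a) c0.
  have sz : size (take (n - a) tau) = n - a by rewrite size_take st; case: ifP; lia.
  rewrite -[in RHS]sz; apply/all_pred1P/(all_nthP c0) => i; rewrite sz => hi.
  by rewrite nth_take //=; apply/eqP; apply: (t0 i.+1); lia.
have suf : drop (2 * n - (n - b)) tau = nseq (n - b) c1.
  have sz : size (drop (2 * n - (n - b)) tau) = n - b by rewrite size_drop st; lia.
  rewrite -[in RHS]sz; apply/all_pred1P/(all_nthP c0) => i; rewrite sz => hi.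
  rewrite nth_drop /=; apply/eqP; set k := _ + i.
  rewrite -[nth _ _ _]/(letter tau k.+1).
  have [E|ne] := eqVneq k.+1 (2 * n); first by rewrite E (dyck_last htau hn).
  by apply: t1; rewrite /k in ne *; lia.
rewrite -{1}[tau](cat_take_drop (n - a)) pre; congr (_ ++ _).
rewrite -[LHS](cat_take_drop (2 * n - (n - a) - (n - b))); congr (_ ++ _).
by rewrite drop_drop -suf; congr drop; lia.
Qed.
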